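(* Let $K_1,\dots,K_s \subseteq R\cdot B^d$ be convex sets, where $B^d$ is the unit Euclidean ball in $\mathbb{R}^d$, and server $P_i$ holds $K_i$; let $c \in \mathbb{R}^d$ be known to all servers. The communication complexity of solving the convex optimization problem $\min\{c^Tx : x \in \bigcap_i K_i\}$ to within additive error $\epsilon$, i.e., finding a point $y$ with $c^Ty \le \mathrm{OPT} + \epsilon$ and $y \in \bigcap_i K_i + \epsilon B^d$, is $O(sd^2\log(Rd/\epsilon)\log d)$.
   Context: There are $s$ servers $P_1,\dots,P_s$ and a coordinator; communication complexity is the total number of bits exchanged. $\mathrm{OPT} = \min\{c^Tx : x\in\bigcap_i K_i\}$.
   Formalization: The condition on y is read as y ∈ ⋂_i (K_i + εB^d), since for (⋂_i K_i) + εB^d no bound in s, d, R, ε holds (two nearly parallel segments); ⋂_i K_i is assumed nonempty and each log factor means max(1, ln ·), as log d = 0 at d = 1. *)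

(* Defs.v *)
From mathcomp Require Import all_boot all_order all_algebra.
From mathcomp Require Import all_classical all_reals all_analysis.

Set Implicit Arguments.
Unset Strict Implicit.
Unset Printing Implicit Defensive.

Import Order.TTheory GRing.Theory Num.Theory.

Local Open Scope classical_set_scope.
Local Open Scope ring_scope.

(* Deterministic protocols in the coordinator model: s servers, each with a
   private two-way channel to a coordinator who holds no input.  X is the type
   of one server's input, Y the type of the coordinator's output.

   The history of a channel is the list of the bits that crossed it, in order
   and in both directions.  Whose turn it is to write the next bit on channel i
   depends only on the history of that channel ([server_turn]), so both of its
   ends know it and no information passes through the scheduling.  A server
   computes its bits from its own input and from its own channel only.

   The coordinator sees the whole transcript, a list of pairs (channel, bit).
   It either stops with an output ([inr y]) or selects a channel ([inl (i, b)]):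
   if it is server i's turn the coordinator receives a bit from it (and b is
   ignored), otherwise it sends the bit b to server i. *)
Record protocol (s : nat) (X Y : Type) := Protocol {
  server_turn : 'I_s -> seq bool -> bool;
  server_bit : 'I_s -> X -> seq bool -> bool;
  coordinator : seq ('I_s * bool) -> ('I_s * bool) + Y }.

Section Run.
Variables (s : nat) (X Y : Type) (p : protocol s X Y) (x : 'I_s -> X).
Implicit Type t : seq ('I_s * bool).

Definition channel t (i : 'I_s) : seq bool := [seq e.2 | e <- t & e.1 == i].

Definition next_bit t (i : 'I_s) (b : bool) : bool :=
  if server_turn p i (channel t i) then server_bit p i (x i) (channel t i)
  else b.

(* Bits that some server still has to send when the coordinator stops would
   escape the count, so stopping then is not a valid termination. *)
Definition quiet t : bool := [forall i, ~~ server_turn p i (channel t i)].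

(* [run n t] is the output reached from the transcript t with at most n further
   bits exchanged, if there is one. *)
Fixpoint run (n : nat) t : option Y :=
  match coordinator p t with
  | inr y => if quiet t then Some y else None
  | inl (i, b) => if n is n'.+1 then run n' (rcons t (i, next_bit t i b))
                  else None
  end.

End Run.

(* A communication problem: on an instance z, server i is given [view z i] and
   the coordinator has to output an element of [sol z]; [valid] is the set of
   instances on which this is required. *)
Definition solves (s : nat) (I X Y : Type) (view : I -> 'I_s -> X)
    (valid : set I) (sol : I -> set Y) (p : protocol s X Y) (n : nat) : Prop :=
  forall z, valid z -> exists2 y, run p (view z) n [::] = Some y & sol z y.

(* The least number of bits, in total over all channels and in the worst case
   over the instances, with which the problem can be solved (+oo if none). *)
Definition comm_complexity (R : realType) (s : nat) (I X Y : Type)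
    (view : I -> 'I_s -> X) (valid : set I) (sol : I -> set Y) : \bar R :=
  ereal_inf [set (n%:R)%:E | n in
    [set n : nat | exists p : protocol s X Y, solves view valid sol p n]].

Section ConvexOptimization.
Variables (R : realType) (s d : nat).
Notation vec := 'cV[R]_d.

Definition dot (c x : vec) : R := (c^T *m x) 0 0.

(* The norm that MathComp-Analysis puts on matrices is the sup norm. *)
Definition enorm (x : vec) : R := Num.sqrt (dot x x).

Definition eball (r : R) : set vec := [set x | enorm x <= r].

Definition minkowski_sum (A B : set vec) : set vec :=
  [set x + y | x in A & y in B].

Definition cvx_instance : Type := vec * ('I_s -> set vec).

Definition feasible (K : 'I_s -> set vec) : set vec :=
  \bigcap_(i in [set: 'I_s]) K i.

Definition opt (z : cvx_instance) : R := inf (dot z.1 @` feasible z.2).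

(* OPT is meaningful only if the intersection is nonempty. *)
Definition cvx_valid (r : R) : set cvx_instance :=
  [set z | [/\ forall i, convex_set (z.2 i : set (convex_lmodType vec)),
              forall i, z.2 i `<=` eball r
            & feasible z.2 !=set0]].

Definition cvx_view (z : cvx_instance) (i : 'I_s) : vec * set vec :=
  (z.1, z.2 i).

(* The approximate feasibility condition is the intersection of the sets
   K_i + eps B; it is not (the intersection of the K_i) + eps B, for which no
   bound in terms of s, d, r and eps alone is possible. *)
Definition cvx_sol (eps : R) (z : cvx_instance) : set vec :=
  [set y | dot z.1 y <= opt z + eps /\
           feasible (fun i => minkowski_sum (z.2 i) (eball eps)) y].

Definition cvx_complexity (r eps : R) : \bar R :=
  comm_complexity R cvx_view (cvx_valid r) (cvx_sol eps).

End ConvexOptimization.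

(* Logarithm as used in O-bounds, where every logarithmic factor is understood
   to be at least 1. *)
Definition log1 (R : realType) (x : R) : R := Num.max 1 (ln x).

(* Main.v *)
Require Import Defs.
From mathcomp Require Import all_boot all_order all_algebra.
From mathcomp Require Import all_classical all_reals all_analysis.
From mathcomp Require Import ring lra zify.

(* Cutting planes, queried at the center of an inscribed ellipsoid E of nearly
   maximal volume in the polyhedron P of the points not yet excluded.  In each
   of O(d log(R d / eps)) rounds every server sends a cut through the center,
   either one separating it from K_i or the objective cut, together with the
   flags that let the coordinator choose one and broadcast it.

   - A cut through the center of E, even a slightly shallow one, multiplies the
     maximal volume of an inscribed ellipsoid by a constant < 1: an ellipsoid
     E' of almost the same volume beyond the cut would have its center far from
     that of E, and the hull of E and E' would contain a larger ellipsoid.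
   - In the coordinates where E is the unit ball, P has radius O(d).  Hence
     O(log d) bits per coordinate of the normal vector are enough, at the cost
     of a shallower cut.
   - Around the translate of a near-optimal point by - (eps / 2) c / |c| there
     is a ball of radius eps / 4 of solutions.  As long as no solution has been
     queried, the cuts preserve that ball, which bounds the volume below. *)

Set Implicit Arguments.
Unset Strict Implicit.
Unset Printing Implicit Defensive.

Import Order.TTheory GRing.Theory Num.Theory.

(** * Broadcast protocols *)

Lemma eq_mkseq_lt (T : Type) (h1 h2 : nat -> T) k :
  (forall j, j < k -> h1 j = h2 j) -> mkseq h1 k = mkseq h2 k.
Proof. by move=> h; apply/eq_in_map => j; rewrite mem_iota => /h. Qed.

Lemma take_mkseq (T : Type) (h : nat -> T) j k :
  j <= k -> take j (mkseq h k) = mkseq h j.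
Proof. by move=> jk; rewrite /mkseq -map_take take_iota (minn_idPl jk). Qed.

Section Steps.
Variables (s : nat) (X Y : Type) (M : nat) (s_gt0 : 0 < s).
Variables (g : 'I_s -> X -> seq bool -> bool).
Variables (f : seq {ffun 'I_s -> bool} -> bool).
Variables (out : seq {ffun 'I_s -> bool} -> Y).

Definition board (h : seq {ffun 'I_s -> bool}) : seq bool :=
  mkseq (fun j => f (take j.+1 h)) (size h).

Fixpoint history (x : 'I_s -> X) k : seq {ffun 'I_s -> bool} :=
  if k is k'.+1 then
    rcons (history x k') [ffun i => g i (x i) (board (history x k'))]
  else [::].

Definition answers x k : {ffun 'I_s -> bool} :=
  [ffun i => g i (x i) (board (history x k))].

Lemma historyE x k : history x k = mkseq (answers x) k.
Proof. by elim: k => //= k IHk; rewrite mkseqS -IHk. Qed.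

Lemma board_history x k :
  board (history x k) = mkseq (fun j => f (history x j.+1)) k.
Proof.
rewrite /board historyE size_mkseq; apply: eq_mkseq_lt => j jk.
by rewrite historyE take_mkseq.
Qed.

(* The bits are exchanged in [2 * M] phases of [s] bits, one per channel: in
   the even phases the servers answer, in the odd ones the coordinator sends
   the same bit to everybody. *)
Definition scheduled n : 'I_s := Ordinal (ltn_pmod n s_gt0).

Definition read_answers k (t : seq ('I_s * bool)) :=
  mkseq (fun j => [ffun i : 'I_s => (nth (i, false) t (j.*2 * s + i)).2]) k.

(** On each channel the even positions hold the answers of the server and the odd ones the broadcast
    bits, hence the index [j.*2.+1]. The bound on [size h] makes all channels quiet when the
    coordinator stops. *)
Definition step_protocol : protocol s X Y := Protocol
  (fun i h => ~~ odd (size h) && (size h < M.*2))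
  (fun i x h => g i x (mkseq (fun j => nth false h j.*2.+1) (size h)./2))
  (fun t => if M.*2 * s <= size t then inr (out (read_answers M t))
            else inl (scheduled (size t),
                      f (read_answers (size t %/ s)./2.+1 t))).

Section Run.
Variable x : 'I_s -> X.

Definition channel_bit i a :=
  if odd a then f (history x a./2.+1) else answers x a./2 i.

Definition transcript n : seq ('I_s * bool) :=
  mkseq (fun m => (scheduled m, channel_bit (scheduled m) (m %/ s))) n.

Lemma channel_transcript n i :
  channel (transcript n) i = mkseq (channel_bit i) (n %/ s + (i < n %% s)).
Proof.
elim: n => [|n IHn]; first by rewrite div0n mod0n.
rewrite /transcript mkseqS /channel filter_rcons -/(transcript n) /=.
have -> : n.+1 %/ s + (i < n.+1 %% s) =
  n %/ s + (i < n %% s) + (scheduled n == i).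
  rewrite -val_eqE /=; have := ltn_ord i; have := ltn_pmod n s_gt0.
  have E := divn_eq n s; set q := n %/ s in E *; set r := n %% s in E *.
  move=> rs is_; have [rs1|rs1] := ltnP r.+1 s.
    have -> : n.+1 = q * s + r.+1 by lia.
    rewrite divnMDl // modnMDl divn_small // modn_small //; lia.
  have -> : n.+1 = q.+1 * s + 0 by rewrite mulSn; lia.
  rewrite divnMDl // modnMDl div0n mod0n; lia.
case: eqP IHn => [<-|_]; rewrite /channel; last by rewrite addn0 => <-.
by rewrite map_rcons => ->; rewrite /= ltnn addn0 addn1 mkseqS.
Qed.

(** Reading [k] answers requires only the phases up to [2 k - 2]: the broadcast that follows the
    last answer need not have begun. *)
Lemma read_transcript k n : k.*2.-1 * s <= n ->
  read_answers k (transcript n) = history x k.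
Proof.
move=> kn; rewrite historyE; apply: eq_mkseq_lt => j jk; apply/ffunP => i; rewrite ffunE.
have jn : j.*2 * s + i < n.
  apply: leq_trans kn; apply: leq_trans (_ : j.*2.+1 * s <= _).
    by rewrite mulSn addnC ltn_add2r.
  by rewrite leq_mul2r; apply/orP; right; lia.
rewrite nth_mkseq //= divnMDl // divn_small // addn0 /channel_bit.
rewrite odd_double doubleK; congr (answers x j _); apply: val_inj => /=.
by rewrite modnMDl modn_small.
Qed.

Lemma run_step m n : n + m = M.*2 * s ->
  run step_protocol x m (transcript n) = Some (out (history x M)).
Proof.
have size_t k : size (transcript k) = k by rewrite size_mkseq.
elim: m n => [|m IHm] n.
  rewrite addn0 => ->; rewrite /= size_t leqnn read_transcript; last first.
    by rewrite leq_mul2r leq_pred orbT.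
  case: ifP => // /negP[]; apply/forallP => i /=.
  by rewrite channel_transcript size_mkseq modnMl ltn0 addn0 mulnK // ltnn andbF.
move=> nm; have nM : n < M.*2 * s by rewrite -nm; lia.
have phase : n %/ s < M.*2 by rewrite ltn_divLR.
rewrite /= size_t leqNgt nM /= -(IHm n.+1); last by rewrite -nm addSnnS.
congr (run _ _ _ _); rewrite /transcript mkseqS; congr (rcons _ (_, _)).
rewrite -/(transcript n) /next_bit /= channel_transcript /= ltnn addn0.
rewrite size_mkseq phase andbT /channel_bit; case: ifP => [ev|/negbFE od].
  rewrite (negPf ev) /answers ffunE; congr (g _ _ _).
  rewrite board_history; apply: eq_mkseq_lt => j jn.
  have j1 : j.*2.+1 < n %/ s by lia.
  by rewrite nth_mkseq // /channel_bit /= odd_double uphalf_double.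
rewrite od read_transcript //; apply: leq_trans (leq_trunc_div n s).
rewrite leq_mul2r; apply/orP; right.
by rewrite doubleS /= -{2}[n %/ s]odd_double_half od.
Qed.

End Run.

Lemma run_step_protocol x :
  run step_protocol x (M.*2 * s) [::] = Some (out (history x M)).
Proof. exact: (@run_step x _ 0). Qed.

End Steps.

(** * Rounds of words built from single bits *)

Section Words.
Variables (s : nat) (X Y : Type) (N B : nat).
Variables (s_gt0 : 0 < s) (B_gt0 : 0 < B).
Variables (word : 'I_s -> X -> seq (seq bool) -> seq bool).
Variables (out : seq (seq bool) -> Y).
Hypothesis size_word : forall i x us, size (word i x us) = B.

(* In each round every server writes a word; the coordinator publishes the word
   of a server whose first bit is set, or that of an arbitrary server. *)
Definition chosen (P : pred 'I_s) : 'I_s :=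
  odflt (Ordinal s_gt0) [pick i | P i].

Definition selected x us : seq bool :=
  let i := chosen (fun i => head false (word i (x i) us)) in word i (x i) us.

Fixpoint published (x : 'I_s -> X) k : seq (seq bool) :=
  if k is k'.+1 then rcons (published x k') (selected x (published x k'))
  else [::].

Definition chunks (h : seq bool) :=
  mkseq (fun j => take B (drop (j * B) h)) (size h %/ B).

Definition word_bit i x (h : seq bool) : bool :=
  nth false (word i x (chunks h)) (size h %% B).

(** The server is read off the answers at the first position of the current word, so it stays the
    same for all [B] bits. *)
Definition relayed_bit (h : seq {ffun 'I_s -> bool}) : bool :=
  let k := (size h).-1 in
  let v := nth [ffun=> false] h in
  v k (chosen (v (k %/ B * B))).

Lemma publishedE x k :
  published x k = mkseq (fun j => selected x (published x j)) k.
Proof. by elim: k => //= k IHk; rewrite mkseqS -IHk. Qed.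

Definition published_bit x k : bool :=
  nth false (selected x (published x (k %/ B))) (k %% B).

Lemma chunks_published x k :
  chunks (mkseq (published_bit x) k) = published x (k %/ B).
Proof.
rewrite publishedE /chunks size_mkseq; apply: eq_mkseq_lt => j jk.
have jBk : j * B + B <= k.
  by rewrite addnC -mulSn (leq_trans _ (leq_trunc_div k B)) // leq_mul2r jk orbT.
have sz : size (take B (drop (j * B) (mkseq (published_bit x) k))) = B.
  by rewrite size_takel // size_drop size_mkseq; lia.
apply: (@eq_from_nth _ false); rewrite sz ?size_word // => a aB.
rewrite nth_take // nth_drop nth_mkseq; last by lia.
by rewrite /published_bit divnMDl // divn_small // addn0 modnMDl modn_small.
Qed.

Lemma board_published x k :
  board relayed_bit (history word_bit relayed_bit x k) =
  mkseq (published_bit x) k.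
Proof.
elim/ltn_ind: k => k IHk.
have vE j i : j < k -> answers word_bit relayed_bit x j i =
    nth false (word i (x i) (published x (j %/ B))) (j %% B).
  by move=> jk; rewrite ffunE IHk // /word_bit chunks_published size_mkseq.
rewrite board_history; apply: eq_mkseq_lt => j jk.
rewrite historyE /relayed_bit size_mkseq /=.
have jj : j %/ B * B <= j by exact: leq_trunc_div.
rewrite !nth_mkseq // vE // /published_bit /selected.
set c1 := chosen _; set c2 := chosen _; suff -> : c1 = c2 by [].
congr (odflt _ _); apply: eq_pick => i /=.
by rewrite vE ?(leq_ltn_trans jj) // mulnK // modnMl nth0.
Qed.

Lemma word_protocol : exists p : protocol s X Y, forall x,
  run p x ((N * B).*2 * s) [::] = Some (out (published x N)).
Proof.
exists (step_protocol (N * B) s_gt0 word_bit relayed_bit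
  (fun h => out (chunks (board relayed_bit h)))) => x.
by rewrite run_step_protocol board_published chunks_published mulnK.
Qed.

End Words.

Local Open Scope classical_set_scope.
Local Open Scope ring_scope.

(** * The real spectral theorem *)

Section Dot.
Variables (R : realType) (d : nat).
Implicit Types (x y z : 'cV[R]_d) (M : 'M[R]_d) (a : R).

Lemma dotE x y : dot x y = \sum_i x i 0 * y i 0.
Proof. by rewrite /dot mxE; apply: eq_bigr => i _; rewrite mxE. Qed.

Lemma dotC x y : dot x y = dot y x.
Proof. by rewrite !dotE; apply: eq_bigr => i _; rewrite mulrC. Qed.

Lemma dotDl x y z : dot (x + y) z = dot x z + dot y z.
Proof. by rewrite /dot linearD mulmxDl mxE. Qed.

Lemma dotDr x y z : dot z (x + y) = dot z x + dot z y.
Proof. by rewrite dotC dotDl !(dotC z). Qed.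

Lemma dotZl a x y : dot (a *: x) y = a * dot x y.
Proof. by rewrite /dot linearZ -scalemxAl mxE. Qed.

Lemma dotZr a x y : dot x (a *: y) = a * dot x y.
Proof. by rewrite dotC dotZl dotC. Qed.

Lemma dotNl x y : dot (- x) y = - dot x y.
Proof. by rewrite -scaleN1r dotZl mulN1r. Qed.

Lemma dotNr x y : dot x (- y) = - dot x y.
Proof. by rewrite dotC dotNl dotC. Qed.

Lemma dotBl x y z : dot (x - y) z = dot x z - dot y z.
Proof. by rewrite dotDl dotNl. Qed.

Lemma dotBr x y z : dot z (x - y) = dot z x - dot z y.
Proof. by rewrite dotDr dotNr. Qed.

Lemma dot0l x : dot 0 x = 0.
Proof. by rewrite -(scale0r 0) dotZl mul0r. Qed.

Lemma dot_mulmx M x y : dot x (M *m y) = dot (M^T *m x) y.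
Proof. by rewrite /dot trmx_mul trmxK mulmxA. Qed.

Lemma dot_ge0 x : 0 <= dot x x.
Proof. by rewrite dotE sumr_ge0 // => i _; rewrite -expr2 sqr_ge0. Qed.

Lemma dot_eq0 x : (dot x x == 0) = (x == 0).
Proof.
apply/eqP/eqP => [|->]; last by rewrite dot0l.
rewrite dotE => /eqP; rewrite psumr_eq0 => [|i _]; last first.
  by rewrite -expr2 sqr_ge0.
move=> /allP h; apply/matrixP => i j; rewrite ord1 mxE.
by apply/eqP; have := h i (mem_index_enum _); rewrite /= mulf_eq0 orbb.
Qed.

Lemma dot_gt0 x : x != 0 -> 0 < dot x x.
Proof. by rewrite lt0r dot_eq0 dot_ge0 => ->. Qed.

Definition psd M := forall x, 0 <= dot x (M *m x).

(** The form is nonnegative on the span of [x] and [y]. If [c > 0], evaluate it at [c x - b y]; if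
    [c = 0], a nonzero [b] would produce the value [-1]. *)
Lemma psd_CauchySchwarz M x y : M^T = M -> psd M ->
  dot x (M *m y) ^+ 2 <= dot x (M *m x) * dot y (M *m y).
Proof.
move=> symM pM.
set a := dot x (M *m x); set b := dot x (M *m y); set c := dot y (M *m y).
have E s t : 0 <= s ^+ 2 * a + 2 * s * t * b + t ^+ 2 * c.
  have := pM (s *: x + t *: y).
  rewrite mulmxDr -!scalemxAr !(dotDl, dotDr, dotZl, dotZr) -/a -/b -/c.
  have -> : dot y (M *m x) = b by rewrite /b dot_mulmx symM dotC.
  lra.
have c0 : 0 <= c by exact: pM.
have a0 : 0 <= a by exact: pM.
have [c_gt0|] := ltP 0 c.
  have := E c (- b); have -> : c ^+ 2 * a + 2 * c * - b * b + (- b) ^+ 2 * c =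
    c * (a * c - b ^+ 2) by ring.
  by rewrite pmulr_rge0 // subr_ge0.
move=> c_le0; have c00 : c = 0 by apply/le_anti/andP.
have [->|b_neq0] := eqVneq b 0; first by rewrite expr0n /= mulr_ge0.
have := E 1 (- (a + 1) / (2 * b)); rewrite c00.
have -> : 1 ^+ 2 * a + 2 * 1 * (- (a + 1) / (2 * b)) * b +
          (- (a + 1) / (2 * b)) ^+ 2 * 0 = -1 by field.
by rewrite ler0N1.
Qed.

Lemma CauchySchwarz x y : dot x y ^+ 2 <= dot x x * dot y y.
Proof.
have := @psd_CauchySchwarz 1%:M x y (tr_scalar_mx _ _) _.
by rewrite !mul1mx; apply => z; rewrite mul1mx dot_ge0.
Qed.

Lemma enorm_ge0 x : 0 <= enorm x. Proof. exact: sqrtr_ge0. Qed.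

Lemma sqr_enorm x : enorm x ^+ 2 = dot x x.
Proof. by rewrite sqr_sqrtr // dot_ge0. Qed.

Lemma enorm_eq0 x : (enorm x == 0) = (x == 0).
Proof. by rewrite -sqrf_eq0 sqr_enorm dot_eq0. Qed.

Lemma enorm0 : enorm (0 : 'cV[R]_d) = 0.
Proof. by apply/eqP; rewrite enorm_eq0. Qed.

Lemma enorm_gt0 x : x != 0 -> 0 < enorm x.
Proof. by rewrite lt0r enorm_eq0 enorm_ge0 => ->. Qed.

Lemma normr_dot x y : `|dot x y| <= enorm x * enorm y.
Proof.
rewrite -(ler_pXn2r (ltn0Sn 1)) ?nnegrE ?mulr_ge0 ?enorm_ge0 //.
by rewrite exprMn !sqr_enorm real_normK ?num_real // CauchySchwarz.
Qed.

Lemma dot_le x y : dot x y <= enorm x * enorm y.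
Proof. exact: le_trans (ler_norm _) (normr_dot x y). Qed.

Lemma enormZ a x : enorm (a *: x) = `|a| * enorm x.
Proof.
rewrite /enorm dotZl dotZr mulrA -expr2 sqrtrM ?sqr_ge0 //.
by rewrite sqrtr_sqr.
Qed.

Lemma enormN x : enorm (- x) = enorm x.
Proof. by rewrite -scaleN1r enormZ normrN1 mul1r. Qed.

Lemma enormD x y : enorm (x + y) <= enorm x + enorm y.
Proof.
rewrite -(ler_pXn2r (ltn0Sn 1)) ?nnegrE ?addr_ge0 ?enorm_ge0 //.
rewrite sqr_enorm dotDl !dotDr (dotC y) sqrrD !sqr_enorm.
have := dot_le x y; lra.
Qed.

Lemma enorm_unit x : x != 0 -> enorm ((enorm x)^-1 *: x) = 1.
Proof.
move=> /enorm_gt0 x0; rewrite enormZ ger0_norm ?mulVf ?gt_eqF //.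
by rewrite invr_ge0 ltW.
Qed.

Lemma psd_shift M : exists C, psd (C%:M - M).
Proof.
exists (\sum_i \sum_j `|M i j|) => x.
rewrite mulmxBl mul_scalar_mx dotBr dotZr subr_ge0 [dot x (M *m x)]dotE.
have xx i : x i 0 ^+ 2 <= dot x x.
  rewrite dotE (bigD1 i) //= -expr2 lerDl sumr_ge0 // => j _.
  by rewrite -expr2 sqr_ge0.
rewrite mulr_suml; apply: ler_sum => i _.
rewrite mxE mulr_sumr mulr_suml; apply: ler_sum => j _.
apply: le_trans (ler_norm _) _; rewrite mulrCA normrM ler_wpM2l //.
have := xx i; have := xx j; rewrite ler_norml.
have := sqr_ge0 (x i 0 - x j 0); have := sqr_ge0 (x i 0 + x j 0).
rewrite sqrrD sqrrB => *; apply/andP; lra.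
Qed.

End Dot.

Section Spectral.
Variable R : realType.

(* [m0] is the largest eigenvalue: were [m0%:M - S] invertible, it would be
   bounded below by a positive multiple of the identity. *)
Lemma sym_eigenvector n (S : 'M[R]_n.+1) : S^T = S ->
  exists (l : R) (x : 'cV_n.+1), enorm x = 1 /\ S *m x = l *: x.
Proof.
move=> symS; pose A : set R := [set m : R | psd (m%:M - S)].
have hA : has_inf A.
  split; first by have [C hC] := psd_shift S; exists C.
  pose e : 'cV[R]_n.+1 := delta_mx 0 0.
  exists (dot e (S *m e)) => m /(_ e).
  rewrite mulmxBl mul_scalar_mx dotBr dotZr subr_ge0.
  suff -> : dot e e = 1 by rewrite mulr1.
  by rewrite /dot trmx_delta mul_delta_mx mxE !eqxx.
set m0 := inf A; pose M := m0%:M - S.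
have symM : M^T = M by rewrite linearB /= tr_scalar_mx symS.
have psdM : psd M.
  move=> x; rewrite mulmxBl mul_scalar_mx dotBr dotZr subr_ge0.
  apply/ler_addgt0Pr => e e0.
  have xx : 0 < dot x x + 1 by have := dot_ge0 x; lra.
  have [a Aa am] := inf_adherent (divr_gt0 e0 xx) hA.
  have := Aa x; rewrite mulmxBl mul_scalar_mx dotBr dotZr subr_ge0.
  move/le_trans; apply.
  apply: le_trans (_ : (m0 + e / (dot x x + 1)) * dot x x <= _).
    by rewrite ler_wpM2r ?dot_ge0 // ltW.
  rewrite mulrDl lerD2l mulrAC ler_pdivrMr // ler_wpM2l ?ltW //.
  by rewrite ltrDl.
have : \det M == 0.
  apply/negPn/negP => detM; have uM : M \in unitmx by rewrite unitmxE unitfE.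
  have [C hC] := psd_shift (invmx M); pose K := Num.max C 1.
  have K0 : 0 < K by rewrite lt_max ltr01 orbT.
  have hK x : dot x (invmx M *m x) <= K * dot x x.
    have := hC x; rewrite mulmxBl mul_scalar_mx dotBr dotZr subr_ge0.
    by move/le_trans; apply; rewrite ler_wpM2r ?dot_ge0 // le_max lexx.
  have : A (m0 - K^-1).
    move=> x; have -> : (m0 - K^-1)%:M - S = M - K^-1%:M.
      by rewrite raddfB /= /M addrAC.
    rewrite mulmxBl mul_scalar_mx dotBr dotZr subr_ge0.
    have [->|x0] := eqVneq x 0; first by rewrite dot0l mulr0 dot0l.
    (* Cauchy-Schwarz for [M] between [x] and its preimage gives [M >= K^-1], so that [m0] could be
       lowered. *)
    have := psd_CauchySchwarz x (invmx M *m x) symM psdM.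
    rewrite mulKVmx // (dotC (_ *m x)) => h.
    have := le_trans h (ler_wpM2l (psdM x) (hK x)).
    rewrite expr2 mulrA ler_pM2r ?dot_gt0 // => h'.
    by rewrite ler_pdivrMl // mulrC.
  move=> /(ge_inf hA.2); rewrite -/m0.
  have : 0 < K^-1 by rewrite invr_gt0.
  lra.
move=> /det0P[v v0 vM].
have x0 : v^T != 0 by rewrite trmx_eq0.
have Mx : M *m v^T = 0 by rewrite -symM -trmx_mul vM trmx0.
exists m0, ((enorm v^T)^-1 *: v^T); split; first exact: enorm_unit.
rewrite -scalemxAr scalerA mulrC -scalerA; congr (_ *: _).
by apply/eqP; rewrite eq_sym -subr_eq0 -mul_scalar_mx -mulmxBl -/M Mx.
Qed.

(** The reflection that negates [x - e] exchanges two vectors of equal norm. *)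
Lemma householder n (e x : 'cV[R]_n) : enorm e = 1 -> enorm x = 1 ->
  exists Q : 'M[R]_n, [/\ Q^T = Q, Q *m Q = 1%:M & Q *m e = x].
Proof.
move=> e1 x1; have [<-|ex] := eqVneq e x.
  by exists 1%:M; rewrite trmx1 !mul1mx.
have ee : dot e e = 1 by rewrite -sqr_enorm e1 expr1n.
have xx : dot x x = 1 by rewrite -sqr_enorm x1 expr1n.
pose w := x - e; have w0 : w != 0 by rewrite subr_eq0 eq_sym.
have ww0 := dot_gt0 w0.
have ww : dot w w = - 2 * dot w e.
  by rewrite /w !(dotBl, dotBr) ee xx (dotC e x); ring.
have mulww (u : 'cV[R]_n) : w *m w^T *m u = dot w u *: w.
  by rewrite -mulmxA [w^T *m u]mx11_scalar mul_mx_scalar.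
pose k := 2 / dot w w.
pose Q : 'M[R]_n := 1%:M - k *: (w *m w^T).
have Qu (u : 'cV[R]_n) : Q *m u = u - (k * dot w u) *: w.
  by rewrite mulmxBl mul1mx -scalemxAl mulww scalerA.
exists Q; split.
- by rewrite linearB linearZ /= trmx1 trmx_mul trmxK.
- rewrite /Q mulmxBr mulmx1 -scalemxAr mulmxA -/Q Qu.
  have -> : w - (k * dot w w) *: w = - w.
    rewrite /k divfK ?gt_eqF // scaler_nat mulr2n opprD addrA subrr.
    by rewrite sub0r.
  by rewrite mulNmx scalerN opprK subrK.
- rewrite Qu; have -> : k * dot w e = -1.
    rewrite /k ww; field; by move: ww0; rewrite ww; case: eqP => // ->; rewrite mulr0 ltxx.
  by rewrite scaleN1r opprK addrC subrK.
Qed.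

(** Deflation: a reflection takes the first basis vector to an eigenvector, which splits off a block
    of size one. *)
Theorem spectral_sym n (S : 'M[R]_n) : S^T = S ->
  exists (U : 'M[R]_n) (D : 'rV[R]_n), U^T *m U = 1%:M /\ S = U *m diag_mx D *m U^T.
Proof.
elim: n S => [|n IHn] S symS.
  by exists 1%:M, 0; split; apply/matrixP => - [].
have [l [x [x1 Sx]]] := sym_eigenvector symS.
pose e : 'cV[R]_(1 + n) := col_mx 1%:M 0.
have e1 : enorm e = 1.
  rewrite /enorm /dot /e tr_col_mx mul_row_col trmx1 mulmx1 mulmx0 addr0.
  by rewrite mxE sqrtr1.
have [Q [symQ QQ Qe]] := householder e1 x1.
pose T : 'M[R]_(1 + n) := Q *m S *m Q.
have symT : T^T = T by rewrite !trmx_mul symQ symS mulmxA.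
have Te : T *m e = l *: e.
  by rewrite /T -!mulmxA Qe Sx -scalemxAr -Qe mulmxA QQ mul1mx.
have defT : T = block_mx l%:M 0 0 (drsubmx T).
  rewrite -{1}[T]submxK; move: Te; rewrite -{1}[T]submxK /e mul_block_col.
  rewrite !mulmx1 !mulmx0 !addr0 scale_col_mx scaler0 => /eq_col_mx[h1 h2].
  have h3 : ursubmx T = 0 by rewrite -[T]symT -trmx_dlsub h2 trmx0.
  by rewrite h1 h2 h3 scalemx1.
have symS' : (drsubmx T)^T = drsubmx T by rewrite trmx_drsub symT.
have [U [D [UU SU]]] := IHn _ symS'.
pose B : 'M[R]_(1 + n) := block_mx 1%:M 0 0 U.
pose D1 : 'rV[R]_(1 + n) := row_mx l%:M D.
have BB : B^T *m B = 1%:M.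
  rewrite /B tr_block_mx mulmx_block !trmx0 trmx1 !mulmx0 !mul0mx !mulmx1.
  by rewrite !addr0 add0r UU -scalar_mx_block.
have defT' : T = B *m diag_mx D1 *m B^T.
  rewrite /B /D1 diag_mx_row tr_block_mx !mulmx_block.
  rewrite !trmx0 trmx1 !mulmx0 !mul0mx !mulmx1 !mul1mx !addr0 !add0r.
  rewrite !mul0mx {1}defT SU.
  by congr (block_mx _ _ _ _); apply/matrixP => i j; rewrite !ord1 !mxE.
exists (Q *m B), D1; split.
  by rewrite trmx_mul symQ -mulmxA (mulmxA Q) QQ mul1mx.
have {1}-> : S = Q *m T *m Q.
  by rewrite /T !mulmxA QQ mul1mx -mulmxA QQ mulmx1.
by rewrite trmx_mul symQ defT' !mulmxA.
Qed.

End Spectral.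

(** * Factorizations of symmetric matrices and determinants *)

Section Factor.
Variables (R : realType) (n : nat).
Implicit Types (S U L : 'M[R]_n) (p x u v : 'cV[R]_n) (D a : 'rV[R]_n).

Lemma sqr_enorm_trmul L p : enorm (L^T *m p) ^+ 2 = dot p (L *m L^T *m p).
Proof. by rewrite sqr_enorm -dot_mulmx mulmxA. Qed.

Lemma enorm_orthogonal U x : U *m U^T = 1%:M -> enorm (U^T *m x) = enorm x.
Proof. by move=> UU; rewrite {1}/enorm -dot_mulmx mulmxA UU mul1mx. Qed.

Lemma enorm_col_orthogonal U i : U^T *m U = 1%:M -> enorm (col i U) = 1.
Proof.
move=> UU; rewrite colE -{1}[U]trmxK enorm_orthogonal ?trmxK //.
by rewrite /enorm /dot trmx_delta mul_delta_mx mxE !eqxx sqrtr1.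
Qed.

Lemma dot_diag D x : dot x (diag_mx D *m x) = \sum_i D 0 i * x i 0 ^+ 2.
Proof.
by rewrite dotE; apply: eq_bigr => i _; rewrite mul_diag_mx mxE; ring.
Qed.

Lemma sqr_enorm_diag a x :
  enorm (diag_mx a *m x) ^+ 2 = \sum_i a 0 i ^+ 2 * x i 0 ^+ 2.
Proof.
rewrite sqr_enorm dotE; apply: eq_bigr => i _.
by rewrite mul_diag_mx mxE; ring.
Qed.

Lemma spectral_eigenvalue S U D i : U^T *m U = 1%:M ->
  S = U *m diag_mx D *m U^T -> D 0 i = dot (col i U) (S *m col i U).
Proof.
move=> UU ->; rewrite colE -!mulmxA (mulmxA U^T) UU mul1mx dot_mulmx mulmxA UU.
rewrite mul1mx dot_diag (bigD1 i) //= big1 ?addr0 ?mxE ?eqxx ?expr1n ?mulr1 //.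
by move=> j ji; rewrite mxE (negPf ji) expr0n mulr0.
Qed.

Lemma psd_factor S : S^T = S -> psd S -> exists L, L *m L^T = S.
Proof.
move=> symS psdS; have [U [D [UU SU]]] := spectral_sym symS.
have D0 i : 0 <= D 0 i by rewrite (spectral_eigenvalue i UU SU).
exists (U *m diag_mx (\row_i Num.sqrt (D 0 i))).
rewrite trmx_mul tr_diag_mx !mulmxA -(mulmxA U) mulmx_diag {}SU.
congr (_ *m diag_mx _ *m _); apply/rowP => i.
by rewrite !mxE -expr2 sqr_sqrtr.
Qed.

Lemma sqr_det_orthogonal U : U^T *m U = 1%:M -> \det U ^+ 2 = 1.
Proof.
by move=> /(congr1 determinant); rewrite det_mulmx det_tr det1 -expr2.
Qed.

(** An ellipsoid determines its matrix up to an orthogonal factor on the right, so [L1] may be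
    replaced by [L1 U], where [U] diagonalizes [A A^T]. The entries of [a] are the semiaxes of the
    second ellipsoid relative to the first. *)
Lemma simultaneous_diagonalization L1 L2 :
  L1 \in unitmx -> L2 \in unitmx ->
  exists L a, [/\ \det L ^+ 2 = \det L1 ^+ 2,
    \det L2 ^+ 2 = \det L1 ^+ 2 * \prod_i a 0 i ^+ 2,
    forall i, 0 < a 0 i,
    forall p, enorm (L^T *m p) = enorm (L1^T *m p) &
    forall p, enorm (diag_mx a *m (L^T *m p)) = enorm (L2^T *m p)].
Proof.
move=> u1 u2; pose A := invmx L1 *m L2.
have uA : A \in unitmx by rewrite unitmx_mul unitmx_inv u1.
have symS : (A *m A^T)^T = A *m A^T by rewrite trmx_mul trmxK.
have [U [D [UU SU]]] := spectral_sym symS.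
have D0 i : 0 < D 0 i.
  rewrite (spectral_eigenvalue i UU SU) -sqr_enorm_trmul exprn_gt0 //.
  apply: enorm_gt0; apply/negP => /eqP h.
  have := enorm_col_orthogonal i UU.
  have -> : col i U = 0.
    have uAT : A^T \in unitmx by rewrite unitmx_tr.
    by rewrite -(mulKmx uAT (col i U)) h mulmx0.
  by rewrite /enorm dot0l sqrtr0 => /eqP; rewrite eq_sym oner_eq0.
exists (L1 *m U), (\row_i Num.sqrt (D 0 i)); split.
- by rewrite det_mulmx exprMn (sqr_det_orthogonal UU) mulr1.
- rewrite -[in LHS](mulKVmx u1 L2) -/A det_mulmx exprMn; congr (_ * _).
  rewrite expr2 -[X in _ * X]det_tr -det_mulmx SU !det_mulmx det_tr mulrAC.
  rewrite -expr2 (sqr_det_orthogonal UU) mul1r det_diag.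
  by apply: eq_bigr => i _; rewrite mxE sqr_sqrtr // ltW.
- by move=> i; rewrite mxE sqrtr_gt0.
- by move=> p; rewrite trmx_mul -mulmxA (enorm_orthogonal _ (mulmx1C UU)).
- move=> p; apply/eqP.
  rewrite -(eqrXn2 (ltn0Sn 1)) ?enorm_ge0 // sqr_enorm_diag.
  transitivity (dot (L1^T *m p) (A *m A^T *m (L1^T *m p)) == enorm (L2^T *m p) ^+ 2).
    congr (_ == _); rewrite SU -!mulmxA dot_mulmx dot_diag trmx_mul -mulmxA.
    by apply: eq_bigr => i _; rewrite mxE sqr_sqrtr // ltW.
  by rewrite -sqr_enorm_trmul mulmxA -trmx_mul /A mulKVmx // eqxx.
Qed.

(** Two block triangular factorizations of one matrix are compared. *)
Lemma det_rank1 u v : \det (1%:M + u *m v^T) = 1 + dot v u.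
Proof.
pose B : 'M[R]_(1 + n) := block_mx 1%:M (- v^T) u 1%:M.
have h1 : B = block_mx 1%:M 0 u 1%:M *m block_mx 1%:M (- v^T) 0 (1%:M + u *m v^T).
  rewrite mulmx_block !mul1mx !mul0mx !mulmx1 !addr0 mulmxN.
  by rewrite addrCA addNr addr0.
have h2 : B = block_mx (1%:M + v^T *m u) (- v^T) 0 1%:M *m block_mx 1%:M 0 u 1%:M.
  rewrite mulmx_block !mul1mx !mul0mx !mulmx1 mulmx0 !add0r mulNmx.
  by rewrite addrK.
have := congr1 determinant h2; rewrite h1 !det_mulmx !det_lblock !det_ublock.
by rewrite !det1 !mul1r !mulr1 det_mx11 => ->; rewrite mxE [1%:M 0 0]mxE eqxx.
Qed.

End Factor.

(** * Inscribed ellipsoids *)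

Section Ellipsoids.
Variables (R : realType) (d : nat).
Notation ellipsoid := ('cV[R]_d * 'M[R]_d)%type.
Implicit Types (E : ellipsoid) (p z w y : 'cV[R]_d) (L : 'M[R]_d).

(* The support function of the ellipsoid [E.1 + E.2 B], B the unit ball. *)
Definition supp E p : R := dot p E.1 + enorm (E.2^T *m p).

(** Otherwise [c ^+ 2] exceeds the squares of [a - al] and [b + al], whose sum is [2 a b + al ^+ 2]
    plus the square of [a - b - al]. *)
Lemma le_max_of_sqr (a b c al : R) : 0 <= a -> 0 <= b ->
  c ^+ 2 <= a * b + al ^+ 2 / 2 -> c <= Num.max (a - al) (b + al).
Proof.
move=> a0 b0 h; rewrite le_max; apply/orP.
have [|h1] := leP c (a - al); first by left.
have [|h2] := leP c (b + al); first by right.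
have c0 : 0 < c by lra.
have : (a - al) ^+ 2 < c ^+ 2.
  rewrite -subr_gt0 subr_sqr mulr_gt0 //; lra.
have : (b + al) ^+ 2 < c ^+ 2.
  rewrite -subr_gt0 subr_sqr mulr_gt0 //; lra.
have := sqr_ge0 (a - b - al); nra.
Qed.

(* Averaging two support functions geometrically: if [b] is the length of the
   vector [diag a q] and [al] half the displacement of the centers, the squared
   maximum of the two supports is at least [|q| b + al^2 / 2]. *)
Lemma mean_ellipsoid L (a : 'rV[R]_d) z1 z2 :
  L \in unitmx -> (forall i, 0 < a 0 i) ->
  let w := invmx L *m (z2 - z1) in
  exists L3,
    \det L3 ^+ 2 = \det L ^+ 2 *
       (\prod_i a 0 i * (1 + (\sum_i (w i 0) ^+ 2 / a 0 i) / 8)) /\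
    forall p, supp (2^-1 *: (z1 + z2), L3) p <=
      Num.max (supp (z1, L) p) (dot p z2 + enorm (diag_mx a *m (L^T *m p))).
Proof.
(* For [al = dot q w / 2] the rank one term contributes exactly [al ^+ 2 / 2] to the squared
   support; the diagonal term is bounded by Cauchy-Schwarz. *)
move=> uL a0 w; pose S0 := diag_mx a + 8^-1 *: (w *m w^T).
pose S := L *m S0 *m L^T.
have symS : S^T = S.
  have symS0 : S0^T = S0.
    by rewrite /S0 linearD linearZ /= tr_diag_mx trmx_mul trmxK.
  by rewrite /S !trmx_mul trmxK symS0 mulmxA.
have wwq (q : 'cV[R]_d) : w *m w^T *m q = dot w q *: w.
  by rewrite -mulmxA [w^T *m q]mx11_scalar mul_mx_scalar.
have SE p : dot p (S *m p) = dot (L^T *m p) (diag_mx a *m (L^T *m p)) +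
    (dot (L^T *m p) w) ^+ 2 / 8.
  rewrite /S -!mulmxA dot_mulmx mulmxDl dotDr; congr (_ + _).
  by rewrite -scalemxAl wwq !dotZr (dotC w); ring.
have psdS : psd S.
  move=> p; rewrite SE addr_ge0 ?divr_ge0 ?sqr_ge0 // dot_diag.
  by rewrite sumr_ge0 // => i _; rewrite mulr_ge0 ?sqr_ge0 // ltW.
have [L3 L3S] := psd_factor symS psdS.
exists L3; split.
  have -> : \det L3 ^+ 2 = \det S by rewrite -L3S det_mulmx det_tr expr2.
  rewrite /S !det_mulmx det_tr mulrAC -expr2; congr (_ * _).
  pose u : 'cV[R]_d := \col_i (w i 0 / (8 * a 0 i)).
  have -> : S0 = diag_mx a *m (1%:M + u *m w^T).
    rewrite mulmxDr mulmx1 mulmxA /S0; congr (_ + _).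
    rewrite scalemxAl; congr (_ *m _); apply/colP => i.
    by rewrite mul_diag_mx !mxE; field; rewrite gt_eqF.
  rewrite det_mulmx det_diag det_rank1; congr (_ * (1 + _)).
  rewrite dotE mulr_suml; apply: eq_bigr => i _; rewrite [u i 0]mxE.
  by field; rewrite gt_eqF.
move=> p; set q := L^T *m p.
have qw : dot q w = dot p z2 - dot p z1.
  by rewrite /q -dot_mulmx /w mulKVmx // dotBr.
have := @le_max_of_sqr (enorm q) (enorm (diag_mx a *m q)) (enorm (L3^T *m p))
  (dot q w / 2) (enorm_ge0 _) (enorm_ge0 _).
rewrite sqr_enorm_trmul L3S SE -/q => /(_ _)/wrap[].
  by have := dot_le q (diag_mx a *m q); lra.
rewrite /supp /= dotZr dotDr qw -/q !le_max => /orP[] h; apply/orP.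
  by left; lra.
by right; lra.
Qed.

Lemma le_exprn n (x y : R) : 0 <= x -> x <= y -> x ^+ n <= y ^+ n.
Proof. by move=> x0 xy; rewrite lerXn2r // nnegrE; exact: le_trans xy. Qed.

(* The bound on the support function of [E3] says that [E3] lies in the convex
   hull of [E1] and [E2].  If some semiaxis of [E2], relative to [E1], is at
   most 1/2, then the arithmetic means of the semiaxes have a larger product
   than the geometric ones; otherwise the centers are far apart and the hull has
   room in the direction joining them. *)
Lemma hull_ellipsoid E1 E2 p0 :
  E1.2 \in unitmx -> E2.2 \in unitmx -> p0 != 0 ->
  supp E2 p0 <= dot p0 E1.1 + enorm (E1.2^T *m p0) / 4 ->
  exists E3, (forall p, supp E3 p <= Num.max (supp E1 p) (supp E2 p)) /\
    (65 / 64) ^+ 2 * (\det E1.2 ^+ 2 * \det E2.2 ^+ 2) <= (\det E3.2 ^+ 2) ^+ 2.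
Proof.
case: E1 E2 => [z1 L1] [z2 L2] /= u1 u2 p0_neq0; rewrite /supp /= => hp0.
have [L [a [dL dL2 a0 eL1 eL2]]] := simultaneous_diagonalization u1 u2.
have uL : L \in unitmx.
  by move: u1; rewrite !unitmxE !unitfE -(sqrf_eq0 (\det L)) dL sqrf_eq0.
have pa0 : 0 <= \prod_i a 0 i by rewrite prodr_ge0 // => i _; rewrite ltW.
have [[i ai]|ha] := pselect (exists i, a 0 i <= 2^-1).
  pose m : 'rV[R]_d := \row_i ((1 + a 0 i) / 2).
  exists (2^-1 *: (z1 + z2), L *m diag_mx m); split=> [p|] /=.
    rewrite -eL1 -eL2 trmx_mul tr_diag_mx -mulmxA; set q := L^T *m p.
    have : enorm (diag_mx m *m q) <= (enorm q + enorm (diag_mx a *m q)) / 2.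
      have mE (x : 'cV[R]_d) : diag_mx m *m x = 2^-1 *: (x + diag_mx a *m x).
        by rewrite !mul_diag_mx; apply/colP => j; rewrite !mxE; ring.
      rewrite mE enormZ ger0_norm ?invr_ge0 ?ler0n // mulrC.
      by rewrite ler_wpM2r ?invr_ge0 ?ler0n // enormD.
    rewrite dotZr dotDr le_max => h; apply/orP.
    set x := _ + _ in h *.
    have [|?] := leP (2^-1 * (dot p z1 + dot p z2) + enorm (diag_mx m *m q))
       (dot p z1 + enorm q); first by left.
    by right; rewrite /x in h; lra.
  rewrite det_mulmx det_diag [(\det L * _) ^+ 2]exprMn dL dL2 mulrA -expr2 prodrXl mulrA.
  have -> : (65 / 64) ^+ 2 * (\det L1 ^+ 2) ^+ 2 * (\prod_i a 0 i) ^+ 2 =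
    (\det L1 ^+ 2 * (65 / 64 * \prod_i a 0 i)) ^+ 2 by ring.
  apply: le_exprn.
    by apply: mulr_ge0; [exact: sqr_ge0|rewrite mulr_ge0 ?divr_ge0 ?ler0n].
  rewrite ler_wpM2l ?sqr_ge0 // -prodrXl (bigD1 i) //= [leRHS](bigD1 i) //=.
  rewrite mulrA ler_pM ?mulr_ge0 ?prodr_ge0 ?divr_ge0 ?ler0n //.
  - exact/ltW.
  - by move=> j _; exact/ltW.
  - by rewrite mxE; have := a0 i; nra.
  - apply: ler_prod => j _; rewrite ltW //= mxE.
    by have := sqr_ge0 (a 0 j - 1); lra.
have {}ha i : 2^-1 <= a 0 i.
  by rewrite leNgt; apply/negP => hi; apply: ha; exists i; exact/ltW.
have [L3 [dL3 hL3]] := mean_ellipsoid z1 z2 uL a0.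
exists (2^-1 *: (z1 + z2), L3); split=> [p|] /=.
  by apply: le_trans (hL3 p) _; rewrite /supp /= eL1 eL2.
move: dL3; set w := invmx L *m _; set r := \sum_i _ => dL3.
(* This gives the factor [1 + r / 8 >= 65 / 64]. *)
suff r8 : 8^-1 <= r.
  have -> : (65 / 64) ^+ 2 * (\det L1 ^+ 2 * \det L2 ^+ 2) =
      (\det L1 ^+ 2 * (\prod_i a 0 i * (65 / 64))) ^+ 2.
    by rewrite dL2 prodrXl; ring.
  rewrite dL3 dL; apply: le_exprn.
    by apply: mulr_ge0; [exact: sqr_ge0|rewrite mulr_ge0 ?divr_ge0 ?ler0n].
  by rewrite ler_wpM2l ?sqr_ge0 // ler_wpM2l //; lra.
set q := L^T *m p0.
have q0 : 0 < enorm q.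
  apply: enorm_gt0; apply: contra p0_neq0 => /eqP h.
  by rewrite -(@mulKmx _ _ _ L^T _ p0) ?unitmx_tr // -/q h mulmx0.
rewrite -eL1 -eL2 -/q in hp0.
set b := enorm (diag_mx a *m q) in hp0.
have bq : enorm q / 2 <= b.
  rewrite -(ler_pXn2r (ltn0Sn 1)) ?nnegrE ?divr_ge0 ?enorm_ge0 //.
  rewrite /b sqr_enorm_diag exprMn sqr_enorm dotE mulr_suml ler_sum // => i _.
  rewrite -expr2 mulrC ler_wpM2r ?sqr_ge0 // ler_pXn2r ?nnegrE ?invr_ge0 //.
  exact/ltW.
have qw : dot q w = dot p0 z2 - dot p0 z1.
  by rewrite /q -dot_mulmx /w mulKVmx // dotBr.
(* As [enorm q <= 2 b], the cut forces [dot q w <= enorm q / 4 - b <= - b / 2]. *)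
have qw2 : (b / 2) ^+ 2 <= dot q w ^+ 2.
  rewrite -[leRHS]sqrrN ler_pXn2r ?nnegrE ?divr_ge0 ?enorm_ge0 //; lra.
have sdiag : (diag_mx a)^T = diag_mx a by rewrite tr_diag_mx.
have pdiag : psd (diag_mx a).
  move=> x; rewrite dot_diag sumr_ge0 // => i _.
  by rewrite mulr_ge0 ?sqr_ge0 // ltW.
(* Bounds [dot q w ^+ 2] by [2 b ^+ 2 r], so that [r >= 1 / 8]. *)
have := psd_CauchySchwarz q (\col_i (w i 0 / a 0 i)) sdiag pdiag.
have -> : diag_mx a *m (\col_i (w i 0 / a 0 i)) = w.
  by rewrite mul_diag_mx; apply/colP => i; rewrite 2!mxE; field; rewrite gt_eqF.
have -> : dot (\col_i (w i 0 / a 0 i)) w = r.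
  by rewrite dotE; apply: eq_bigr => i _; rewrite mxE expr2 mulrAC.
have : dot q (diag_mx a *m q) <= 2 * b ^+ 2.
  rewrite /b sqr_enorm_diag dot_diag mulr_sumr ler_sum // => i _.
  rewrite mulrA ler_wpM2r ?sqr_ge0 //; have := ha i; nra.
have r0 : 0 <= r.
  by rewrite sumr_ge0 // => i _; rewrite divr_ge0 ?sqr_ge0 // ltW.
move=> /(ler_wpM2r r0) h1 h2.
have b2 : 0 < b ^+ 2 by rewrite exprn_gt0 //; lra.
have : b ^+ 2 * 8^-1 <= b ^+ 2 * r by lra.
by rewrite ler_pM2l.
Qed.

End Ellipsoids.

(** * Ellipsoids of nearly maximal volume *)

Section NearMax.
Variables (R : realType) (d : nat).
Notation ellipsoid := ('cV[R]_d * 'M[R]_d)%type.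
Implicit Types (E : ellipsoid) (H : set ('cV[R]_d * R)) (p y t : 'cV[R]_d).

Definition polyhedron H : set 'cV[R]_d :=
  [set x | forall pb, H pb -> dot pb.1 x <= pb.2].

Definition inscribed H E := forall pb, H pb -> supp E pb.1 <= pb.2.

(** A near maximum exists without a compactness argument. The slack [129 / 128] stays below the gain
    [65 / 64 = 130 / 128] of the hull. *)
Definition near_max H E := [/\ E.2 \in unitmx, inscribed H E &
  forall E', inscribed H E' -> \det E'.2 ^+ 2 <= 129 / 128 * \det E.2 ^+ 2].

Lemma sqr_det_gt0 n (L : 'M[R]_n) : L \in unitmx -> 0 < \det L ^+ 2.
Proof. by rewrite unitmxE unitfE lt0r sqrf_eq0 sqr_ge0 andbT. Qed.

Lemma near_max_exists H E0 B : E0.2 \in unitmx -> inscribed H E0 ->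
  (forall E, inscribed H E -> \det E.2 ^+ 2 <= B) -> exists E, near_max H E.
Proof.
move=> u0 i0 hB; pose S : set R := [set \det E.2 ^+ 2 | E in inscribed H].
have hS : has_sup S.
  by split; [exists (\det E0.2 ^+ 2), E0|exists B => _ [E /hB ? <-]].
have ub E : inscribed H E -> \det E.2 ^+ 2 <= sup S.
  by move=> iE; apply: ub_le_sup hS.2 _ _; exists E.
have V0 : 0 < sup S := lt_le_trans (sqr_det_gt0 u0) (ub _ i0).
(* [1 - 1 / 129 = 128 / 129] is the inverse of the allowed slack. *)
have V1 : 0 < sup S / 129 by rewrite divr_gt0.
have [_ [E iE <-] hE] := sup_adherent V1 hS.
exists E; split=> // [|E' /ub]; last by lra.
by rewrite unitmxE unitfE -sqrf_eq0 gt_eqF //; lra.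
Qed.

(** The large ellipsoid in the hull of [E] and [E'] is inscribed too, so near maximality bounds it;
    dividing [129 / 128] by [65 / 64] leaves [129 / 130]. *)
Lemma near_max_cut H E E' p : near_max H E -> inscribed H E' -> p != 0 ->
  supp E' p <= dot p E.1 + enorm (E.2^T *m p) / 4 ->
  \det E'.2 ^+ 2 <= 129 / 130 * \det E.2 ^+ 2.
Proof.
move=> [uE iE mE] iE' p0 hp; have dE := sqr_det_gt0 uE.
have [u'|nu] := boolP (E'.2 \in unitmx); last first.
  have -> : \det E'.2 = 0.
    by apply/eqP; move: nu; rewrite unitmxE unitfE negbK.
  by rewrite expr0n mulr_ge0 ?divr_ge0 ?ler0n // ltW.
have [E3 [hE3 dE3]] := hull_ellipsoid uE u' p0 hp.
have iE3 : inscribed H E3.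
  move=> pb Hpb; apply: le_trans (hE3 _) _.
  by rewrite ge_max iE //= iE'.
have := le_trans dE3 (le_exprn 2 (sqr_ge0 _) (mE _ iE3)).
move=> h; rewrite -(ler_pM2l dE); have := sqr_ge0 (\det E.2 ^+ 2); lra.
Qed.

Lemma le_Bernoulli (x : R) n : 0 <= x <= 1 -> 1 - n%:R * x <= (1 - x) ^+ n.
Proof.
move=> /andP[x0 x1]; elim: n => [|n IHn]; first by rewrite mul0r subr0 expr0.
rewrite exprS -natr1; have n0 : 0 <= n%:R :> R by rewrite ler0n.
by have := ler_wpM2l (_ : 0 <= 1 - x) IHn; rewrite subr_ge0 => /(_ x1); nra.
Qed.

(* A far point [y] of the polyhedron would give a larger ellipsoid, spanned by
   [E] and its image under a homothety of ratio [1 - 1 / (2 d)] centered at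
   [y]. *)
Lemma near_max_radius H E y : (0 < d)%N -> near_max H E -> polyhedron H y ->
  enorm (invmx E.2 *m (y - E.1)) <= 10 * d%:R.
Proof.
case: E => z L d_gt0 [/= uE iE mE] Hy; set u := invmx L *m (y - z).
have dR : 1 <= d%:R :> R by rewrite ler1n.
pose k : R := (2 * d%:R)^-1.
have k0 : 0 < k by rewrite invr_gt0; lra.
have kd : d%:R * k = 1 / 2.
  by rewrite /k; field; rewrite pnatr_eq0 -lt0n.
have k1 : k <= 1 / 2 by rewrite -kd ler_peMl // ltW.
have a0 (i : 'I_d) : 0 < (const_mx (1 - k) : 'rV[R]_d) 0 i.
  by rewrite mxE; lra.
have [L3 []] := mean_ellipsoid z (z + k *: (y - z)) uE a0.
rewrite addrAC subrr add0r -scalemxAr -/u => dL3 hL3.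
have iE3 : inscribed H (2^-1 *: (z + (z + k *: (y - z))), L3).
  move=> pb Hpb; apply: le_trans (hL3 _) _; rewrite ge_max iE //=.
  have -> : diag_mx (const_mx (1 - k)) *m (L^T *m pb.1) = (1 - k) *: (L^T *m pb.1).
    by rewrite diag_const_mx mul_scalar_mx.
  rewrite enormZ ger0_norm; last by lra.
  rewrite dotDr dotZr dotBr; have := iE _ Hpb; have := Hy _ Hpb; rewrite /supp /=.
  nra.
have := mE _ iE3; rewrite /= dL3 mulrC ler_pM2r ?sqr_det_gt0 //.
have -> : \prod_(i < d) (const_mx (1 - k) : 'rV[R]_d) 0 i = (1 - k) ^+ d.
  by rewrite (eq_bigr (fun=> 1 - k)) ?prodr_const ?card_ord // => i _; rewrite mxE.
have : 1 / 2 <= (1 - k) ^+ d.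
  apply: le_trans (le_Bernoulli d _); last by apply/andP; split; lra.
  by rewrite kd; lra.
have : k ^+ 2 * enorm u ^+ 2 <=
    \sum_i (k *: u) i 0 ^+ 2 / (const_mx (1 - k) : 'rV[R]_d) 0 i.
  rewrite sqr_enorm dotE mulr_sumr ler_sum // => i _.
  rewrite !mxE exprMn -expr2 ler_pdivlMr; last by lra.
  by rewrite ler_piMr; [|apply: mulr_ge0; exact: sqr_ge0|lra].
set P := _ ^+ d; set s := \sum_i _ => hs hP h.
have s0 : 0 <= s by apply: le_trans hs; rewrite mulr_ge0 ?sqr_ge0.
(* [P >= 1 / 2] leaves [1 + s / 8 <= 129 / 64]. Since [d k = 1 / 2], the square of [enorm u] is then
   at most [33 d ^+ 2]. *)
have {}h : s <= 33 / 4 by nra.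
rewrite -(ler_pXn2r (ltn0Sn 1)) ?nnegrE ?enorm_ge0 ?mulr_ge0 ?ler0n //.
have d2 : 0 < d%:R ^+ 2 :> R by rewrite exprn_gt0 //; lra.
have e : d%:R ^+ 2 * k ^+ 2 = 1 / 4 by rewrite -exprMn kd; field.
have := ler_wpM2l (ltW d2) (le_trans hs h).
rewrite mulrA e exprMn; lra.
Qed.

Definition unit_constraints (r : R) : set ('cV[R]_d * R) :=
  [set pb | enorm pb.1 = 1 /\ pb.2 = r].

(** The eigenvalues of [L L^T] are the squared semiaxes. Adding the constraints at [p] and [- p]
    cancels the center and bounds each semiaxis by [r]. *)
Lemma inscribed_unit_constraints r E : inscribed (unit_constraints r) E ->
  \det E.2 ^+ 2 <= (r ^+ 2) ^+ d.
Proof.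
case: E => z L /= iE; have symS : (L *m L^T)^T = L *m L^T.
  by rewrite trmx_mul trmxK.
have [U [D [UU SU]]] := spectral_sym symS.
have -> : \det L ^+ 2 = \prod_i D 0 i.
  rewrite expr2 -[X in _ * X]det_tr -det_mulmx SU !det_mulmx det_tr mulrAC.
  by rewrite -expr2 (sqr_det_orthogonal UU) mul1r det_diag.
have -> : (r ^+ 2) ^+ d = \prod_(i < d) r ^+ 2.
  by rewrite prodr_const card_ord.
apply: ler_prod => i _; rewrite (spectral_eigenvalue i UU SU) -sqr_enorm_trmul.
rewrite sqr_ge0 /= le_exprn ?enorm_ge0 //; set p := col i U.
have p1 : enorm p = 1 by exact: enorm_col_orthogonal.
have h1 := iE (p, r) (conj p1 erefl).
have h2 := iE (- p, r) (conj (etrans (enormN _) p1) erefl).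
by move: h1 h2; rewrite /supp /= mulmxN enormN dotNl; lra.
Qed.

Lemma supp_ball t (rho : R) p : 0 <= rho ->
  supp (t, rho%:M) p = dot p t + rho * enorm p.
Proof.
by move=> r0; rewrite /supp /= tr_scalar_mx mul_scalar_mx enormZ ger0_norm.
Qed.

Lemma inscribed_ball H t (rho : R) : 0 <= rho ->
  inscribed H (t, rho%:M) <->
  (forall y, enorm (y - t) <= rho -> polyhedron H y).
Proof.
move=> r0; split=> [h y yt pb Hpb|h pb Hpb].
  apply: le_trans (h _ Hpb); rewrite supp_ball //.
  rewrite -{1}(subrK t y) addrC dotDr lerD2l mulrC.
  by apply: le_trans (dot_le _ _) _; rewrite ler_wpM2l ?enorm_ge0.
rewrite supp_ball //; have [p0|p0] := eqVneq pb.1 0.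
  have := h t; rewrite subrr enorm0 => /(_ r0 _ Hpb).
  by rewrite p0 enorm0 mulr0 addr0.
have := h (t + rho *: ((enorm pb.1)^-1 *: pb.1)).
rewrite addrAC subrr add0r enormZ enorm_unit // ger0_norm // mulr1.
move=> /(_ (lexx _) _ Hpb); rewrite dotDr !dotZr -sqr_enorm expr2 mulKf //.
by rewrite enorm_eq0.
Qed.

Lemma det_ball (rho : R) : \det (rho%:M : 'M[R]_d) ^+ 2 = (rho ^+ 2) ^+ d.
Proof. by rewrite det_scalar exprAC. Qed.

(* Rounding the normal vector is harmless in the coordinates where [E] is the
   unit ball, since the polyhedron has radius at most [10 d] there. *)
Lemma rounded_cut H E v q' y : (0 < d)%N -> near_max H E -> polyhedron H y ->
  v != 0 -> dot v y <= dot v E.1 ->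
  enorm (q' - (enorm (E.2^T *m v))^-1 *: (E.2^T *m v)) <= (80 * d%:R)^-1 ->
  [/\ (invmx E.2)^T *m q' != 0, E.2^T *m ((invmx E.2)^T *m q') = q' &
  dot ((invmx E.2)^T *m q') y <= dot ((invmx E.2)^T *m q') E.1 + enorm q' / 4].
Proof.
move=> d0 nE Hy v0 hv; set w := E.2^T *m v; set q := _ *: w => hq.
have [uE _ _] := nE; have uT : E.2^T \in unitmx by rewrite unitmx_tr.
have dR : 1 <= d%:R :> R by rewrite ler1n.
have w0 : w != 0.
  by apply: contra v0 => /eqP h; rewrite -(mulKmx uT v) -/w h mulmx0.
have q1 : enorm q = 1 by exact: enorm_unit.
have e80 : (80 * d%:R)^-1 <= 1 / 2 :> R.
  by rewrite invf_ple ?posrE //; lra.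
have q'1 : 1 / 2 <= enorm q'.
  have := enormD q' (q - q'); rewrite addrC subrK q1.
  by rewrite -opprB enormN; lra.
have Kq' : E.2^T *m ((invmx E.2)^T *m q') = q'.
  by rewrite trmx_inv mulKVmx.
split=> //.
  apply/negP => /eqP h; move: Kq'; rewrite h mulmx0 => q'0.
  by move: q'1; rewrite -q'0 enorm0; lra.
rewrite addrC -lerBlDr -dotBr -dot_mulmx; set u := invmx E.2 *m _.
have hu : enorm u <= 10 * d%:R by exact: near_max_radius Hy.
have qu : dot q u <= 0.
  rewrite dotZl mulr_ge0_le0 ?invr_ge0 ?enorm_ge0 //.
  by rewrite -dot_mulmx mulKVmx // dotBr subr_le0.
have := dot_le (q' - q) u; rewrite dotBl.
(* The rounding error times the radius is [1 / 8], at most [enorm q' / 4] as [enorm q' >= 1 / 2]. *)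
have : enorm (q' - q) * enorm u <= (80 * d%:R)^-1 * (10 * d%:R).
  by rewrite ler_pM ?enorm_ge0.
have -> : (80 * d%:R)^-1 * (10 * d%:R) = 1 / 8 :> R.
  by field; rewrite pnatr_eq0 -lt0n.
by move: q'1; lra.
Qed.

End NearMax.

(** * The cutting plane protocol *)

Lemma fixed_length_code (W : finType) n : (#|W| <= 2 ^ n)%N ->
  exists (enc : W -> seq bool) (dec : seq bool -> option W),
    (forall w, size (enc w) = n) /\ pcancel enc dec.
Proof.
move=> Wn; have card_n : (#|W| <= #|{: n.-tuple bool}|)%N.
  by rewrite card_tuple card_bool.
pose enc (w : W) : n.-tuple bool := enum_val (widen_ord card_n (enum_rank w)).
exists (fun w => tval (enc w)), (fun h => [pick w | tval (enc w) == h]).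
split=> [w|w]; first by rewrite size_tuple.
case: pickP => [w' /eqP/val_inj/enum_val_inj/(congr1 val)/= h|/(_ w)/=].
  by congr Some; apply: enum_rank_inj; apply: val_inj.
by rewrite eqxx.
Qed.

(** * Rounding and encoding of vectors *)

Section Grid.
Variables (R : realType) (d : nat).
Hypothesis d_gt0 : (0 < d)%N.

(** This allows at least [256 d ^ 2] values, enough for a grid of [160 d ^ 2 + 1] points. *)
Definition coord_bits := (8 + 2 * up_log 2 d)%N.

Lemma coord_le_enorm (q : 'cV[R]_d) i : `|q i 0| <= enorm q.
Proof.
rewrite -(ler_pXn2r (ltn0Sn 1)) ?nnegrE ?enorm_ge0 // sqr_enorm dotE.
rewrite real_normK ?num_real // (bigD1 i) //= -expr2 lerDl sumr_ge0 // => j _.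
by rewrite -expr2 sqr_ge0.
Qed.

Lemma enorm_le_coord (q : 'cV[R]_d) (a : R) : 0 <= a ->
  (forall i, `|q i 0| <= a) -> enorm q <= d%:R * a.
Proof.
move=> a0 qa; rewrite -(ler_pXn2r (ltn0Sn 1)) ?nnegrE ?enorm_ge0 ?mulr_ge0 //.
rewrite sqr_enorm dotE; apply: le_trans (_ : \sum_(i < d) a ^+ 2 <= _).
  apply: ler_sum => i _; rewrite -expr2 -real_normK ?num_real //.
  by rewrite le_exprn.
rewrite sumr_const card_ord -[a ^+ 2 *+ d]mulr_natl exprMn ler_wpM2r ?sqr_ge0 //.
by rewrite -natrX ler_nat expnS expn1 leq_pmulr.
Qed.

(** Coordinates in [[-1, 1]] are rounded down to a grid of step [1 / (80 d ^ 2)]; the norm of the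
    error is at most [d] times its largest coordinate. *)
Lemma unit_vector_code :
  exists (enc : 'cV[R]_d -> seq bool) (dec : seq bool -> 'cV[R]_d),
    (forall q, size (enc q) = (coord_bits * d)%N) /\
    (forall q, enorm q <= 1 -> enorm (dec (enc q) - q) <= (80 * d%:R)^-1).
Proof.
pose k := (160 * d ^ 2)%N; pose W := {ffun 'I_d -> 'I_k.+1}.
have [|enc [dec [size_enc encK]]] := @fixed_length_code W (coord_bits * d).
  rewrite card_ffun !card_ord expnM leq_exp2r // /coord_bits expnD mulnC expnM.
  rewrite /k; have := up_logP d (ltnSn 1); set a := (2 ^ _)%N => da.
  have : (d ^ 2 <= a ^ 2)%N by rewrite leq_exp2r.
  have : (0 < d ^ 2)%N by rewrite expn_gt0 d_gt0.
  by rewrite -expnM (mulnC 2) expnM -/a; lia.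
pose K : R := 80 * d%:R ^+ 2.
have K0 : 0 < K by rewrite mulr_gt0 // exprn_gt0 // ltr0n.
pose rd (q : 'cV[R]_d) : W := [ffun i => inord (Num.truncn ((q i 0 + 1) * K))].
pose un (w : W) : 'cV[R]_d := \col_i ((w i)%:R / K - 1).
exists (fun q => enc (rd q)), (fun h => oapp un 0 (dec h)).
split=> [q|q q1]; first exact: size_enc.
rewrite encK /=; have -> : (80 * d%:R)^-1 = d%:R * K^-1 :> R.
  by rewrite /K; field; rewrite pnatr_eq0 -lt0n.
apply: enorm_le_coord => [|i]; first by rewrite invr_ge0 ltW.
rewrite !mxE ffunE; have := le_trans (coord_le_enorm q i) q1.
rewrite ler_norml => /andP[q_ge q_le]; set x := (q i 0 + 1) * K.
have x0 : 0 <= x by apply: mulr_ge0; [lra|exact: ltW].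
have xk : (Num.truncn x < k.+1)%N.
  rewrite truncn_lt_nat // -natr1 /k natrM natrX -/K.
  have : x <= 2 * K by apply: ler_wpM2r; [exact: ltW|lra].
  by rewrite /K; lra.
rewrite inordK //; have /andP[] := truncn_itv x0; set m := Num.truncn x.
rewrite -natr1 => m1 m2.
have -> : m%:R / K - 1 - q i 0 = (m%:R - x) / K.
  by rewrite /x; field; rewrite gt_eqF.
have Ki : 0 <= K^-1 by rewrite invr_ge0 ltW.
rewrite normrM (ger0_norm Ki) ler_piMl //.
by rewrite ler_norml; apply/andP; split; lra.
Qed.

End Grid.

(** * Separation from a neighborhood of a convex set *)

Section Separation.
Variables (R : realType) (d : nat).
Implicit Types (K : set 'cV[R]_d) (x y z v e : 'cV[R]_d).

Lemma convex_setE K x y (l : R) : convex_set (K : set (convex_lmodType 'cV[R]_d)) ->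
  0 <= l <= 1 -> K x -> K y -> K (l *: x + (1 - l) *: y).
Proof.
move=> cK /andP[l0 l1] Kx Ky.
by have /set_mem := cK x y (Itv01 l0 l1) (mem_set Kx) (mem_set Ky).
Qed.

Lemma sqr_dist_line v x (l : R) : dot (v - l *: x) (v - l *: x) =
  dot v v - 2 * l * dot v x + l ^+ 2 * dot x x.
Proof. by rewrite !(dotBl, dotBr, dotZl, dotZr) (dotC x v); ring. Qed.

(* [K] need not be closed, hence an approximate nearest point. *)
Lemma approximate_separation K (r eps : R) z :
  convex_set (K : set (convex_lmodType 'cV[R]_d)) -> K `<=` eball r ->
  K !=set0 -> 0 < eps -> ~ minkowski_sum K (eball eps) z ->
  exists v, v != 0 /\
    forall x e, K x -> enorm e <= 3 / 4 * eps -> dot v (x + e) <= dot v z.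
Proof.
move=> cK Kr [x1 Kx1] eps0 Kz.
pose D : set R := [set dot (z - x) (z - x) | x in K].
have hD : has_inf D.
  split; first by exists (dot (z - x1) (z - x1)), x1.
  by exists 0 => _ [x _ <-]; exact: dot_ge0.
(* Moving a fraction [l] of the way from [x0] to [x] gains less than [l eps ^+ 2 / 4] in squared
   distance; [l] is small enough for the quadratic term to stay below the same bound, whence
   [dot v g <= eps ^+ 2 / 4]. *)
pose l := eps ^+ 2 / (eps ^+ 2 + 16 * r ^+ 2).
have e2 : 0 < eps ^+ 2 by rewrite exprn_gt0.
have den0 : 0 < eps ^+ 2 + 16 * r ^+ 2 by have := sqr_ge0 r; lra.
have l0 : 0 < l by rewrite divr_gt0.
have l1 : l <= 1 by rewrite ler_pdivrMr // mul1r; have := sqr_ge0 r; lra.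
have lr : l * (2 * r ^+ 2) <= eps ^+ 2 / 8.
  have : l * (eps ^+ 2 + 16 * r ^+ 2) = eps ^+ 2 by rewrite divfK ?gt_eqF.
  by have := mulr_gt0 l0 e2; lra.
have th0 : 0 < l * (eps ^+ 2 / 4) by rewrite mulr_gt0 //; lra.
have [_ [x0 Kx0 <-] hx0] := inf_adherent th0 hD.
pose v := z - x0; rewrite -/v in hx0.
have v_eps : eps < enorm v.
  rewrite ltNge; apply/negP => h; apply: Kz; exists x0 => //; exists v => //.
  by rewrite addrC subrK.
exists v; split; first by rewrite -enorm_eq0 gt_eqF //; lra.
move=> x e Kx he; pose g := x - x0.
have g2 : dot g g <= 4 * r ^+ 2.
  rewrite -sqr_enorm; have -> : 4 * r ^+ 2 = (r + r) ^+ 2 by ring.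
  apply: le_exprn; rewrite ?enorm_ge0 //; apply: le_trans (enormD _ _) _.
  by rewrite enormN lerD //; exact: Kr.
have := ge_inf hD.2 (_ : D (dot (v - l *: g) (v - l *: g))).
have -> : v - l *: g = z - (l *: x + (1 - l) *: x0).
  by apply/colP => i; rewrite /v /g !mxE; ring.
move=> /(_ (ex_intro2 _ _ _ (convex_setE cK _ Kx Kx0) erefl)).
rewrite (ltW l0) l1 => /(_ isT).
have -> : z - (l *: x + (1 - l) *: x0) = v - l *: g.
  by apply/colP => i; rewrite /v /g !mxE; ring.
rewrite sqr_dist_line => h.
have vg : dot v g <= eps ^+ 2 / 4.
  rewrite -(ler_pM2l l0).
  have : l * (l * dot g g) <= l * (l * (4 * r ^+ 2)).
    by rewrite !ler_pM2l.
  have := ler_wpM2l (ltW l0) lr; lra.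
(* The margin [3 / 4 * eps] is what [enorm v > eps] leaves after the loss of [eps ^+ 2 / 4]. *)
have ve : dot v e <= enorm v * (3 / 4 * eps).
  by apply: le_trans (dot_le _ _) _; rewrite ler_wpM2l ?enorm_ge0.
have vv : dot v z - dot v x0 = enorm v ^+ 2 by rewrite sqr_enorm -dotBr.
have : dot v g = dot v x - dot v x0 by rewrite dotBr.
rewrite dotDr; have : eps ^+ 2 <= enorm v * eps.
  by rewrite expr2 ler_pM2r // ltW.
have : enorm v * eps <= enorm v ^+ 2.
  by rewrite expr2 ler_wpM2l ?enorm_ge0 // ltW.
lra.
Qed.

End Separation.

(** * The state of the protocol and its invariant *)

Section CuttingPlane.
Variables (R : realType) (s d B : nat) (r eps : R).
Variables (enc : 'cV[R]_d -> seq bool) (dec : seq bool -> 'cV[R]_d).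
Hypotheses (s_gt0 : (0 < s)%N) (d_gt0 : (0 < d)%N) (eps_gt0 : 0 < eps).
Hypothesis size_enc : forall q, size (enc q) = B.
Hypothesis encP :
  forall q, enorm q <= 1 -> enorm (dec (enc q) - q) <= (80 * d%:R)^-1.
Notation vec := 'cV[R]_d.
Notation ellipsoid := (vec * 'M[R]_d)%type.
Implicit Types (H : set (vec * R)) (E : ellipsoid) (y t v c : vec).

(** The choice depends on [H] alone, so servers and coordinator agree on it without
    communication. *)
Definition query H : ellipsoid := xget (0, 0) (near_max H).

(** [q] is a normal vector in the coordinates where [E] is the unit ball; the offset [enorm q / 4]
    absorbs the rounding. *)
Definition cut E q : vec * R :=
  ((invmx E.2)^T *m q, dot ((invmx E.2)^T *m q) E.1 + enorm q / 4).

Definition normal E v : vec := (enorm (E.2^T *m v))^-1 *: (E.2^T *m v).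

(* A word consists of two flags and of the code of a normal vector.  The first
   flag says that the query point violates the constraint of the server, the
   second one that it is not worse than the best point found so far. *)
Definition advance (st : set (vec * R) * option vec) (w : seq bool) :=
  let E := query st.1 in
  (st.1 `|` [set cut E (dec (behead (behead w)))],
   if head false w then st.2 else if nth false w 1 then Some E.1 else st.2).

Definition stage us := 
  foldl advance (unit_constraints (r + eps) : set (vec * R), None) us.

(** The margin [3 / 4 * eps] lets the cut preserve the ball of solutions around the target point. *)
Definition separates (K : set vec) y v := v != 0 /\
  forall x e, K x -> enorm e <= 3 / 4 * eps -> dot v (x + e) <= dot v y.

Definition no_worse c (best : option vec) y : bool :=
  if best is Some y' then dot c y <= dot c y' else true.

(** If no server raises the first flag, the query point lies in all the enlarged sets and all words
    coincide, so any of them may be published. *)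
Definition cvx_word (i : 'I_s) (x : vec * set vec) us : seq bool :=
  let st := stage us in let E := query st.1 in
  if `[< minkowski_sum x.2 (eball eps) E.1 >]
  then [:: false, no_worse x.1 st.2 E.1 & enc (normal E x.1)]
  else [:: true, false & enc (normal E (xget 0 (separates x.2 E.1)))].

Lemma size_cvx_word i x us : size (cvx_word i x us) = B.+2.
Proof. by rewrite /cvx_word; case: ifP => _ /=; rewrite size_enc. Qed.

Lemma cut_ball H E v t (rho : R) : 0 <= rho -> near_max H E -> v != 0 ->
  (forall y, enorm (y - t) <= rho -> polyhedron H y) ->
  (forall y, enorm (y - t) <= rho -> dot v y <= dot v E.1) ->
  let H' := H `|` [set cut E (dec (enc (normal E v)))] in
  (forall y, enorm (y - t) <= rho -> polyhedron H' y) /\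
  (forall E', inscribed H' E' -> \det E'.2 ^+ 2 <= 129 / 130 * \det E.2 ^+ 2).
Proof.
move=> rho0 nE v0 tH tv H'; have uE : E.2 \in unitmx by case: nE.
have w0 : E.2^T *m v != 0.
  apply: contra v0 => /eqP h.
  by rewrite -(@mulKmx _ _ _ E.2^T _ v) ?unitmx_tr // h mulmx0.
have := encP (_ : enorm (normal E v) <= 1).
rewrite {1}/normal enorm_unit // lexx => /(_ isT) hq.
split=> [y yt pb [|->]|E' iE'].
- exact: tH.
- by have [] := rounded_cut d_gt0 nE (tH y yt) v0 (tv y yt) hq.
have tt : enorm (t - t) <= rho by rewrite subrr enorm0.
have [p0 Ep _] := rounded_cut d_gt0 nE (tH t tt) v0 (tv t tt) hq.
apply: (near_max_cut nE _ p0) => [pb Hpb|]; first by apply: iE'; left.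
rewrite Ep; exact: (iE' (cut E (dec (enc (normal E v)))) (or_intror erefl)).
Qed.

Variable z : cvx_instance R s d.
Hypothesis z_valid : cvx_valid r z.

(* The point [x] nearly attains the optimum; moving it against the objective
   turns it into the center of a ball of solutions, whatever the size of the
   objective. *)
Lemma target_ball : exists t, enorm t <= r + eps / 2 /\
  forall y, enorm (y - t) <= eps / 4 -> dot z.1 y <= opt z + eps /\
    forall i, exists x e, [/\ z.2 i x, enorm e <= 3 / 4 * eps & y = x + e].
Proof.
case: z z_valid => c K [/= cK Kr [x0 Kx0]]; pose S := dot c @` feasible K.
have hS : has_inf S.
  split; first by exists (dot c x0), x0.
  exists (- (enorm c * r)) => _ [x Kx <-].
  have xr : enorm x <= r by exact: (Kr (Ordinal s_gt0) x (Kx _ I)).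
  have := normr_dot c x; rewrite ler_norml => /andP[h _].
  by apply: le_trans h; rewrite lerN2 ler_wpM2l ?enorm_ge0.
have [_ [x Kx <-] hx] := inf_adherent eps_gt0 hS.
have xr : enorm x <= r by exact: (Kr (Ordinal s_gt0) x (Kx _ I)).
pose c1 := (enorm c)^-1 *: c.
have c1_le1 : enorm c1 <= 1.
  rewrite /c1; have [->|c0] := eqVneq c 0; last by rewrite enorm_unit.
  by rewrite scaler0 enorm0.
have cc1 : dot c c1 = enorm c.
  rewrite /c1; have [->|c0] := eqVneq c 0; first by rewrite enorm0 dot0l.
  by rewrite dotZr -sqr_enorm expr2 mulKf // enorm_eq0.
have m_le : enorm ((eps / 2) *: c1) <= eps / 2.
  have e0 : 0 <= eps / 2 by rewrite divr_ge0 // ltW.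
  by rewrite enormZ ger0_norm // ler_piMr.
exists (x - (eps / 2) *: c1); split.
  by apply: le_trans (enormD _ _) _; rewrite enormN lerD.
move=> y hy; set e := y - _ in hy.
have ye : y = x + (e - (eps / 2) *: c1).
  by apply/colP => i; rewrite /e !mxE; ring.
split.
  rewrite ye dotDr dotBr dotZr cc1; have := dot_le c e.
  have := ler_wpM2l (enorm_ge0 c) hy; rewrite /opt -/S /= in hx *.
  by have := mulr_ge0 (enorm_ge0 c) (ltW eps_gt0); lra.
move=> i; exists x, (e - (eps / 2) *: c1); split=> //; first exact: Kx.
by apply: le_trans (enormD _ _) _; rewrite enormN; lra.
Qed.

Variable t : vec.
Hypothesis t_norm : enorm t <= r + eps / 2.
Hypothesis t_ball : forall y, enorm (y - t) <= eps / 4 ->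
  dot z.1 y <= opt z + eps /\
  forall i, exists x e, [/\ z.2 i x, enorm e <= 3 / 4 * eps & y = x + e].

(** Before a solution is recorded, any recorded point has value above [opt z + eps], so the first
    query that is a solution replaces it; afterwards only solutions can replace it. *)
Definition invariant k (st : set (vec * R) * option vec) : Prop :=
  (exists2 y, st.2 = Some y & cvx_sol eps z y) \/
  [/\ forall y, st.2 = Some y -> opt z + eps < dot z.1 y,
      forall y, enorm (y - t) <= eps / 4 -> polyhedron st.1 y &
      forall E, inscribed st.1 E ->
        \det E.2 ^+ 2 <= (129 / 130) ^+ k * ((r + eps) ^+ 2) ^+ d].

Lemma rho_gt0 : 0 < eps / 4. Proof. by rewrite divr_gt0. Qed.

Lemma invariant_init : invariant 0 (stage [::]).
Proof.
right; split=> // [y yt [p b] [/= p1 ->]|E iE]; last first.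
  by rewrite expr0 mul1r; exact: inscribed_unit_constraints iE.
apply: le_trans (dot_le _ _) _; rewrite p1 mul1r -(subrK t y).
apply: le_trans (enormD _ _) _; apply: le_trans (lerD yt t_norm) _.
by have := eps_gt0; lra.
Qed.

Lemma near_max_query k (st : set (vec * R) * option vec) :
  (forall y, enorm (y - t) <= eps / 4 -> polyhedron st.1 y) ->
  (forall E, inscribed st.1 E ->
        \det E.2 ^+ 2 <= (129 / 130) ^+ k * ((r + eps) ^+ 2) ^+ d) ->
  near_max st.1 (query st.1).
Proof.
move=> tH bH; apply: xgetPex; have r0 := rho_gt0.
apply: (@near_max_exists _ _ _ (t, (eps / 4)%:M) _ _ _ bH); last first.
  exact/(inscribed_ball _ _ (ltW r0)).
by rewrite unitmxE unitfE -sqrf_eq0 det_ball gt_eqF // !exprn_gt0.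
Qed.

Lemma invariant_step k us : invariant k (stage us) ->
  invariant k.+1
    (advance (stage us) (selected s_gt0 cvx_word (cvx_view z) us)).
Proof.
set st := stage us; set E := query st.1; rewrite /selected.
set P := fun i : 'I_s => head false (cvx_word i (cvx_view z i) us).
have : P (chosen s_gt0 P) \/
    forall i, minkowski_sum (z.2 i) (eball eps) E.1.
  rewrite /chosen; case: pickP => /= [i Pi|nP]; [by left|right=> i].
  have := nP i; rewrite /P /cvx_word -/st -/E.
  by case: ifP => // /asboolP.
move: (chosen _ _) => i.
(* Common to both kinds of cut: one that keeps the ball improves the volume bound by a factor. *)
have bad_step w v : v != 0 -> behead (behead w) = enc (normal E v) ->
    (forall y, enorm (y - t) <= eps / 4 -> dot v y <= dot v E.1) ->
    [/\ forall y, st.2 = Some y -> opt z + eps < dot z.1 y,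
      forall y, enorm (y - t) <= eps / 4 -> polyhedron st.1 y &
      forall E, inscribed st.1 E ->
        \det E.2 ^+ 2 <= (129 / 130) ^+ k * ((r + eps) ^+ 2) ^+ d] ->
    (forall y, (advance st w).2 = Some y -> opt z + eps < dot z.1 y) ->
    invariant k.+1 (advance st w).
  move=> v0 wE tv [_ tH bH] bad; right.
  have nE := near_max_query tH bH.
  have [tH' bH'] := cut_ball (ltW rho_gt0) nE v0 tH tv.
  split=> //=; rewrite -/E wE // => E' /bH'/le_trans; apply.
  rewrite [(129 / 130) ^+ k.+1]exprS -[_ * _ ^+ k * _]mulrA.
  by rewrite ler_wpM2l ?divr_ge0 ?ler0n // bH //; case: nE.
have [inK|outK] := pselect (minkowski_sum (z.2 i) (eball eps) E.1); last first.
  have wE : cvx_word i (cvx_view z i) us =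
      [:: true, false & enc (normal E (xget 0 (separates (z.2 i) E.1)))].
    by rewrite /cvx_word -/st -/E asboolF.
  move=> _ [[y yst ysol]|bad]; first by left; exists y => //; rewrite wE.
  have [cK Kr [x0 Kx0]] := z_valid.
  have [v0 sep] : separates (z.2 i) E.1 (xget 0 (separates (z.2 i) E.1)).
    apply: xgetPex.
    apply: (approximate_separation (cK i) (Kr i) _ eps_gt0 outK).
    by exists x0; exact: Kx0.
  apply: (bad_step _ _ v0) => //.
  - by rewrite wE.
  - by move=> y /t_ball[_ /(_ i)[x [e [Kx he ->]]]]; exact: sep.
  - by rewrite wE; case: bad.
have wE : cvx_word i (cvx_view z i) us =
    [:: false, no_worse z.1 st.2 E.1 & enc (normal E z.1)].
  by rewrite /cvx_word -/st -/E asboolT.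
rewrite /P wE /= => -[//|allK].
have solE : dot z.1 E.1 <= opt z + eps -> cvx_sol eps z E.1.
  by move=> h; split=> // j _; exact: allK.
move=> [[y yst [yopt ysol]]|bad].
  left; rewrite /advance /= yst -/E /no_worse; case: ifP => h.
    by exists E.1 => //; apply: solE; exact: le_trans yopt.
  by exists y.
have [Eopt|Eopt] := leP (dot z.1 E.1) (opt z + eps).
  left; exists E.1; last exact: solE.
  rewrite /= -/E /no_worse; case: bad => bad _ _.
  by case: st.2 bad => // y /(_ y erefl)/ltW/(le_trans Eopt) ->.
(* The whole ball is strictly better than the query point; in particular the objective is nonzero
   and can serve as a normal vector. *)
have tE y : enorm (y - t) <= eps / 4 -> dot z.1 y < dot z.1 E.1.
  by move=> /t_ball[/le_lt_trans-/(_ _ Eopt)].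
apply: (bad_step _ z.1) => //=.
- apply: contraTneq isT => c0; have := tE t; rewrite subrr enorm0 c0 !dot0l.
  by rewrite ltxx => /(_ (ltW rho_gt0)).
- by move=> y /tE/ltW.
- by rewrite -/E => y; case: ifP => [_ [<-]|_]; last by case: bad => + _ _; apply.
Qed.

Lemma invariant_published k :
  invariant k (stage (published s_gt0 cvx_word (cvx_view z) k)).
Proof.
elim: k => [|k IHk]; first exact: invariant_init.
by rewrite /= /stage foldl_rcons; exact: invariant_step.
Qed.

(** Otherwise the ball of radius [eps / 4], still inscribed, would exceed the volume bound. *)
Lemma published_solution N :
  (129 / 130) ^+ N * ((r + eps) ^+ 2) ^+ d < ((eps / 4) ^+ 2) ^+ d ->
  cvx_sol eps z
    (odflt 0 (stage (published s_gt0 cvx_word (cvx_view z) N)).2).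
Proof.
move=> hN; have [[y -> //]|[_ tH bH]] := invariant_published N.
have /bH/= := (inscribed_ball _ _ (ltW rho_gt0)).2 tH.
by rewrite det_ball => /(lt_le_trans hN); rewrite ltxx.
Qed.

End CuttingPlane.

(** A word has two flags besides the code; the doubling counts the answer and the broadcast of each
    bit. *)
Lemma cvx_solves (R : realType) (s d : nat) (r eps : R) N :
  (0 < s)%N -> (0 < d)%N -> 0 < eps ->
  (129 / 130) ^+ N * ((r + eps) ^+ 2) ^+ d < ((eps / 4) ^+ 2) ^+ d ->
  exists p : protocol s _ _, solves (@cvx_view R s d) (cvx_valid r)
    (cvx_sol eps) p ((N * (coord_bits d * d).+2).*2 * s).
Proof.
move=> s0 d0 e0 hN.
have [enc [dec [size_enc encP]]] := unit_vector_code R d0.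
have [p hp] := @word_protocol s _ _ N _ s0 (ltn0Sn _)
  (cvx_word r eps enc dec) (fun us => odflt 0 (stage r eps dec us).2)
  (size_cvx_word r eps dec size_enc).
exists p => z zv.
exists (odflt 0 (stage r eps dec
   (published s0 (cvx_word r eps enc dec) (cvx_view z) N)).2); first exact: hp.
have [t [t1 t2]] := target_ball s0 e0 zv.
exact: (published_solution s0 d0 e0 encP zv t1 t2 hN).
Qed.

(** * Number of rounds and total cost *)

Section Rates.
Variable R : realType.

Lemma log1_ge1 (x : R) : 1 <= log1 x. Proof. by rewrite le_max lexx. Qed.

Lemma le_expR_log1 (x : R) : 0 < x -> x <= expR (log1 x).
Proof. by move=> x0; rewrite -{1}[x]lnK ?posrE // ler_expR le_max lexx orbT. Qed.

(** The ratio of [r + eps] to [eps / 4] is at most [expR (4 l)], so that of the squared volumes is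
    at most [expR (8 d l)]; each round gains a factor [expR (1 / 130)], and [1040 = 8 * 130]. *)
Lemma contraction_lt (d N : nat) (r eps : R) : (0 < d)%N -> 0 < r -> 0 < eps ->
  1040 * d%:R * log1 (r * d%:R / eps) < N%:R ->
  (129 / 130) ^+ N * ((r + eps) ^+ 2) ^+ d < ((eps / 4) ^+ 2) ^+ d.
Proof.
move=> d0 r0 e0; set l := log1 _ => hN.
have dR : 1 <= d%:R :> R by rewrite ler1n.
have l1 : 1 <= l by exact: log1_ge1.
have x0 : 0 < r * d%:R / eps by rewrite divr_gt0 // mulr_gt0 // ltr0n.
have el : r * d%:R / eps <= expR l by exact: le_expR_log1.
have e2 : 2 <= expR l by have := expR_ge1Dx l; lra.
have ratio : r + eps <= eps / 4 * expR (4 * l).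
  have r1 : r <= eps * expR l.
    by move: el; rewrite ler_pdivrMr // mulrC; have := ler_peMr (ltW r0) dR; lra.
  have -> : expR (4 * l) = expR l * expR l ^+ 3.
    by rewrite -exprS expRM_natl.
  have e8 : 8 <= expR l ^+ 3.
    have -> : 8 = 2 ^+ 3 :> R by ring.
    by apply: le_exprn.
  have ee : 0 < eps * expR l by rewrite mulr_gt0 ?expR_gt0.
  have := ler_wpM2l (ltW ee) e8.
  have := ler_wpM2l (ltW e0) e2; lra.
have mu : 129 / 130 <= expR (- (1 / 130)) :> R.
  by apply: le_trans (expR_ge1Dx _); lra.
have a0 : 0 < (eps / 4) ^+ 2 by rewrite exprn_gt0 // divr_gt0.
have h1 : (129 / 130) ^+ N <= expR (- (1 / 130)) ^+ N :> R.
  by apply: le_exprn => //; rewrite divr_ge0.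
have h2 : ((r + eps) ^+ 2) ^+ d <= ((eps / 4) ^+ 2) ^+ d * expR (8 * d%:R * l).
  have -> : expR (8 * d%:R * l) = (expR (4 * l) ^+ 2) ^+ d.
    by rewrite -!expRM_natl; congr expR; ring.
  rewrite -exprMn -[(eps / 4) ^+ 2 * _]exprMn.
  apply: le_exprn; first exact: sqr_ge0.
  by apply: le_exprn => //; rewrite addr_ge0 // ltW.
apply: le_lt_trans (_ : expR (- (1 / 130)) ^+ N *
    (((eps / 4) ^+ 2) ^+ d * expR (8 * d%:R * l)) < _).
  apply: ler_pM h1 h2; last by apply: exprn_ge0; exact: sqr_ge0.
  by rewrite exprn_ge0 // divr_ge0.
rewrite -expRM_natl mulrCA gtr_pMr; last by rewrite exprn_gt0.
by rewrite -expRD expR_lt1; lra.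
Qed.

(** For [d > 1], [2 ^ (u - 1) < d] and [expR (1 / 2) <= 2] give [u <= 2 log1 d + 1]. *)
Lemma up_log_le_log1 d : (0 < d)%N -> (up_log 2 d)%:R <= 3 * log1 (d%:R : R).
Proof.
move=> d0; have l1 := log1_ge1 (d%:R : R).
have [d1|d1] := leqP d 1.
  have -> : up_log 2 d = 0%N by apply/eqP; rewrite up_log_eq0 d1 orbT.
  by lra.
set u := up_log 2 d; have u0 : (0 < u)%N by rewrite up_log_gt0.
have := up_log_gtn (isT : (1 < 2)%N) d1; rewrite -/u => ud.
have half : expR (1 / 2) <= 2 :> R.
  have := expR_ge1Dx (- (1 / 2) : R); rewrite expRN => h.
  rewrite -[leLHS]invrK invf_ple ?posrE ?invr_gt0 ?expR_gt0 //; lra.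
have : expR (1 / 2 * u.-1%:R) <= d%:R :> R.
  rewrite mulrC expRM_natl; apply: le_trans (_ : 2 ^+ u.-1 <= _).
    by apply: le_exprn => //; exact: expR_ge0.
  by rewrite -natrX ler_nat ltnW.
move=> /le_trans/(_ (le_expR_log1 _)); rewrite ltr0n ler_expR => /(_ d0).
by have : u.-1%:R + 1 = u%:R :> R; [rewrite natr1 prednK|lra].
Qed.

End Rates.

Theorem theorem1p7 (R : realType) :
  exists C : R, forall (s d : nat) (r eps : R),
    (0 < s)%N -> (0 < d)%N -> 0 < r -> 0 < eps ->
    (cvx_complexity s d r eps <=
      (C * s%:R * d%:R ^+ 2 * log1 (r * d%:R / eps) * log1 d%:R)%:E)%E.
Proof.
(* [2] counts the two directions, [1041 d l] bounds the number of rounds and [16 d m] the length of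
   a word. *)
exists (2 * 1041 * 16) => s d r eps s0 d0 r0 e0.
set l := log1 (_ / _); set m := log1 _.
have l1 : 1 <= l by exact: log1_ge1.
have m1 : 1 <= m by exact: log1_ge1.
have dR : 1 <= d%:R :> R by rewrite ler1n.
have dl1 : 1 <= d%:R * l by rewrite mulr_ege1.
pose x := 1040 * d%:R * l; pose N := (Num.truncn x).+1.
have Nx : N%:R <= 1041 * (d%:R * l).
  have : (Num.truncn x)%:R <= x by rewrite truncn_le /x; lra.
  by rewrite /N -natr1 /x; lra.
have hB : (coord_bits d * d).+2%:R <= 16 * (d%:R * m).
  have -> : (coord_bits d * d).+2 = (8 * d + 2 * (up_log 2 d * d) + 2)%N.
    by rewrite /coord_bits mulnDl mulnA addn2.
  have := up_log_le_log1 R d0; rewrite -/m !natrD !natrM => h.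
  have := ler_wpM2r (ler0n R d) h; nra.
apply: le_trans (_ : ((N * (coord_bits d * d).+2).*2 * s)%:R%:E <= _)%E.
  apply: ereal_inf_lbound; exists ((N * (coord_bits d * d).+2).*2 * s)%N => //.
  apply: cvx_solves => //; apply: contraction_lt => //.
  exact: truncnS_gt.
rewrite lee_fin natrM -mul2n !natrM.
have : N%:R * (coord_bits d * d).+2%:R <= 1041 * (d%:R * l) * (16 * (d%:R * m)).
  by rewrite ler_pM.
by move=> /(ler_wpM2r (ler0n R s)); lra.
Qed.
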